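(* Let $\mathbb{F}$ be a field of characteristic different from $2$, let $G$ be an abelian group, and let $\mathcal{A}=(\mathcal{C}\otimes\mathcal{B},-)$ be the algebra with involution where $\mathcal{C}$ is a Cayley algebra over $\mathbb{F}$, $\mathcal{B}$ is a Hurwitz algebra over $\mathbb{F}$ of dimension $2$ or $4$, and $-$ denotes the tensor product of the standard involutions of $\mathcal{C}$ and $\mathcal{B}$. Then a decomposition $\Gamma:\mathcal{A}=\bigoplus_{g\in G}\mathcal{A}_g$ into subspaces is a $G$-grading on the algebra with involution $\mathcal{A}$ if and only if there exist $G$-gradings $$\Gamma^1:\ \mathcal{C}=\bigoplus_{g\in G}\mathcal{C}_g\qquad\text{and}\qquad\Gamma^2:\ \mathcal{B}=\bigoplus_{g\in G}\mathcal{B}_g$$ such that for all $g\in G$ $$\mathcal{A}_g=\bigoplus_{g_1,g_2\in G:\ g_1g_2=g}\mathcal{C}_{g_1}\otimes\mathcal{B}_{g_2}.$$ Moreover, if $\Gamma$ and $\Gamma'$ are two $G$-gradings on $\mathcal{A}$, obtained in this way from $(\Gamma^1,\Gamma^2)$ and $((\Gamma')^1,(\Gamma')^2)$ respectively, then $\Gamma$ and $\Gamma'$ are isomorphic if and only if $\Gamma^1$ and $(\Gamma')^1$ are isomorphic gradings on $\mathcal{C}$ and $\Gamma^2$ and $(\Gamma')^2$ are isomorphic gradings on $\mathcal{B}$.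
   Context: A Hurwitz algebra is a unital (not necessarily associative) algebra with a nondegenerate multiplicative quadratic form $n$ (nondegenerate: the polar form $n(x,y)=n(x+y)-n(x)-n(y)$ is nondegenerate); its standard involution is $\bar x=n(x,1)1-x$. A Cayley algebra is an $8$-dimensional Hurwitz algebra. A $G$-grading on an algebra $\mathcal{A}$ is a vector space decomposition $\mathcal{A}=\bigoplus_{g\in G}\mathcal{A}_g$ with $\mathcal{A}_g\mathcal{A}_h\subseteq\mathcal{A}_{gh}$ for all $g,h\in G$. A $G$-grading on an algebra with involution $(\mathcal{A},-)$ is a $G$-grading on $\mathcal{A}$ with $\overline{\mathcal{A}_g}\subseteq\mathcal{A}_g$ for all $g$ (involution preserving grading). Two $G$-gradings on $(\mathcal{A},-)$ are isomorphic if there is an automorphism of $\mathcal{A}$ commuting with the involution and mapping, for every $g\in G$, the component of degree $g$ of the first onto the component of degree $g$ of the second; two $G$-gradings on $\mathcal{C}$ (or $\mathcal{B}$) are isomorphic if there is an algebra automorphism with this property. *)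

(* Defs.v *)
From HB Require Import structures.
From mathcomp Require Import all_boot all_algebra.

Set Implicit Arguments.
Unset Strict Implicit.
Unset Printing Implicit Defensive.

Import GRing.Theory.
Local Open Scope ring_scope.

(* Finite-dimensional algebras, neither associative nor unital in general. *)
HB.mixin Record Vector_hasMul (F : fieldType) A of Vector F A := {
  namul : {bilinear A -> A -> A}
}.
#[short(type="naAlgType")]
HB.structure Definition NAAlgebra (F : fieldType) :=
  {A of Vector F A & Vector_hasMul F A}.

Definition polar (F : fieldType) (V : vectType F) (n : V -> F) (x y : V) : F :=
  n (x + y) - n x - n y.

HB.mixin Record NAAlgebra_isHurwitz (F : fieldType) A of NAAlgebra F A := {
  hone : A;
  hnorm : A -> F;
  hmul1 : left_id hone (@namul F A);
  hmulr1 : right_id hone (@namul F A);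
  hnormZ : forall (a : F) (x : A), hnorm (a *: x) = a ^+ 2 * hnorm x;
  hpolar_bilinear : bilinear_for *%R *%R (@polar F A hnorm);
  hpolar_nondegenerate :
    forall x : A, (forall y : A, polar hnorm x y = 0) -> x = 0;
  hnormM : {morph hnorm : x y / (namul : A -> A -> A) x y >-> x * y}
}.
#[short(type="hurwitzType")]
HB.structure Definition Hurwitz (F : fieldType) :=
  {A of NAAlgebra F A & NAAlgebra_isHurwitz F A}.

Definition hconj (F : fieldType) (A : hurwitzType F) (x : A) : A :=
  polar (@hnorm F A) x hone *: hone - x.

Section TensorSpace.
Variables (F : fieldType).
Implicit Types U V W : vectType F.

(* The tensor product is modelled by coordinate matrices with respect to the
   canonical bases of the factors; [tlift] and the lemmas on it show that this
   model has the universal property of the tensor product. *)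
Definition tensor U V := 'M[F]_(\dim {:U}, \dim {:V}).
HB.instance Definition _ U V := Vector.on (tensor U V).

Definition tens U V (u : U) (v : V) : tensor U V :=
  \matrix_(i, j) (coord (vbasis {:U}) i u * coord (vbasis {:V}) j v).

Definition tlift U V W (h : U -> V -> W) (X : tensor U V) : W :=
  \sum_i \sum_j X i j *: h (vbasis {:U})`_i (vbasis {:V})`_j.

Definition tensv U V (S : {vspace U}) (T : {vspace V}) : {vspace tensor U V} :=
  <<[seq tens u v | u <- vbasis S, v <- vbasis T]>>%VS.

Lemma tens_is_bilinear U V : bilinear_for *:%R *:%R (@tens U V).
Proof.
split=> [v a x y | u a x y]; apply/matrixP=> i j; rewrite !mxE linearP /=.
  by rewrite mulrDl mulrA.
by rewrite mulrDr mulrCA.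
Qed.
HB.instance Definition _ U V :=
  bilinear_isBilinear.Build F U V (tensor U V) *:%R *:%R (@tens U V)
    (@tens_is_bilinear U V).

Lemma tlift_is_linear U V W (h : U -> V -> W) : linear (tlift h).
Proof.
move=> a X Y; rewrite /tlift scaler_sumr -big_split; apply: eq_bigr => i _ /=.
rewrite scaler_sumr -big_split; apply: eq_bigr => j _ /=.
by rewrite !mxE scalerDl scalerA.
Qed.
HB.instance Definition _ U V W (h : U -> V -> W) :=
  GRing.isLinear.Build F (tensor U V) W *:%R (tlift h) (tlift_is_linear h).

Let linear_comb U V (k : U -> V) (n : nat) (a : 'I_n -> F) (x : 'I_n -> U) :
  linear k -> k (\sum_i a i *: x i) = \sum_i a i *: k (x i).
Proof.
move=> k_lin; pose L := GRing.isLinear.Build F U V *:%R k k_lin.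
pose kL : {linear U -> V} := HB.pack k L.
have /= -> := linear_sum kL _ _ (fun i => a i *: x i).
by apply: eq_bigr => i _; have /= -> := linearZ_LR kL (a i) (x i).
Qed.

Lemma tlift_tens U V W (h : U -> V -> W) :
  bilinear_for *:%R *:%R h -> forall u v, tlift h (tens u v) = h u v.
Proof.
move=> [hl hr] u v.
rewrite [in RHS](coord_vbasis (memvf u)) (linear_comb _ _ (hl v)).
apply: eq_bigr => i _.
rewrite [in RHS](coord_vbasis (memvf v)) (linear_comb _ _ (hr _)) scaler_sumr.
by apply: eq_bigr => j _; rewrite scalerA mxE.
Qed.

Lemma tlift_comb U V W (h h1 h2 : U -> V -> W) (a : F) :
  (forall u v, h u v = a *: h1 u v + h2 u v) ->
  forall X, tlift h X = a *: tlift h1 X + tlift h2 X.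
Proof.
move=> hE X; rewrite /tlift scaler_sumr -big_split; apply: eq_bigr => i _ /=.
rewrite scaler_sumr -big_split; apply: eq_bigr => j _ /=.
by rewrite hE scalerDr !scalerA [_ * a]mulrC.
Qed.

Lemma tlift_unique U V W (k : {linear tensor U V -> W}) :
  k =1 tlift (fun u v => k (tens u v)).
Proof.
move=> X; rewrite {1}[X]matrix_sum_delta linear_sum; apply: eq_bigr => i _.
rewrite linear_sum; apply: eq_bigr => j _; rewrite linearZ; congr (_ *: k _).
apply/matrixP=> i' j'; rewrite !mxE.
rewrite !coord_free ?(basis_free (vbasisP _)) //.
by rewrite mulr_natr -mulrnA mulnC mulnb andbC [i' == _]eq_sym [j' == _]eq_sym andbC.
Qed.

Lemma mem_tensv U V (S : {vspace U}) (T : {vspace V}) u v :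
  u \in S -> v \in T -> tens u v \in tensv S T.
Proof.
move=> /coord_vbasis-> /coord_vbasis->; have [tl tr] := @tens_is_bilinear U V.
rewrite (linear_comb _ _ (tl _)); apply: memv_suml => i _; apply: memvZ.
rewrite (linear_comb _ _ (tr _)); apply: memv_suml => j _; apply: memvZ.
by apply/memv_span/allpairs_f; rewrite mem_nth ?size_tuple.
Qed.

Lemma tensv_sub U V (S : {vspace U}) (T : {vspace V}) (Z : {vspace tensor U V}) :
  (forall u v, u \in S -> v \in T -> tens u v \in Z) -> (tensv S T <= Z)%VS.
Proof.
move=> sZ; apply/span_subvP => _ /allpairsP[[u v] [/= uS vT ->]].
by apply: sZ; apply: vbasis_mem.
Qed.

End TensorSpace.

Section TensorAlgebra.
Variables (F : fieldType) (A B : naAlgType F).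

Definition tmul (X Y : tensor A B) : tensor A B :=
  tlift (fun a b => tlift (fun a' b' => tens (namul a a') (namul b b')) Y) X.

Lemma tmul_is_bilinear : bilinear_for *:%R *:%R tmul.
Proof.
split=> [Y | X]; first exact: tlift_is_linear.
by move=> a Y Z; apply: tlift_comb => u v; rewrite tlift_is_linear.
Qed.
HB.instance Definition _ :=
  bilinear_isBilinear.Build F (tensor A B) (tensor A B) (tensor A B)
    *:%R *:%R tmul tmul_is_bilinear.

HB.instance Definition _ := Vector_hasMul.Build F (tensor A B) tmul.

Lemma namul_tens (a a' : A) (b b' : B) :
  namul (tens a b) (tens a' b') = tens (namul a a') (namul b b').
Proof.
rewrite [LHS]tlift_tens.
  by rewrite tlift_tens //; split=> [y | x] c u v; rewrite !linearPr // linearPl.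
by split=> [y | x] c u v; apply: tlift_comb => u' v';
  rewrite linearPl ?linearPl ?linearPr.
Qed.

End TensorAlgebra.

Section TensorInvolution.
Variables (F : fieldType) (C B : hurwitzType F).

Definition tconj (X : tensor C B) : tensor C B :=
  tlift (fun c b => tens (hconj c) (hconj b)) X.

Lemma hconj_is_linear (A : hurwitzType F) : linear (@hconj F A).
Proof.
move=> a x y; rewrite /hconj (hpolar_bilinear.1 hone a x y).
by rewrite scalerDl scalerBr scalerA opprD addrACA.
Qed.

Lemma tconj_tens c b : tconj (tens c b) = tens (hconj c) (hconj b).
Proof.
rewrite /tconj tlift_tens //; split=> [b2 | c2] a x y.
  by rewrite hconj_is_linear linearPl.
by rewrite hconj_is_linear linearPr.
Qed.

End TensorInvolution.

(* [W] is the internal direct sum of the subspaces [U i], [i] in [P]; the index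
   type may be infinite. *)
Definition is_dsum (F : fieldType) (V : vectType F) (I : eqType) (P : pred I)
    (U : I -> {vspace V}) (W : {vspace V}) : Prop :=
  (forall s : seq I, uniq s -> all P s -> directv (\sum_(i <- s) U i)%VS) /\
  (forall v : V, v \in W <->
     exists2 s : seq I, all P s & v \in (\sum_(i <- s) U i)%VS).

Section Gradings.
Variables (F : fieldType) (G : zmodType).

Definition is_decomposition (V : vectType F) (X : G -> {vspace V}) : Prop :=
  is_dsum predT X fullv.

Definition is_grading (A : naAlgType F) (X : G -> {vspace A}) : Prop :=
  is_decomposition X /\
  forall (g h : G) (x y : A),
    x \in X g -> y \in X h -> namul x y \in X (g + h).

Definition is_inv_grading (A : naAlgType F) (inv : A -> A)
    (X : G -> {vspace A}) : Prop :=
  is_grading X /\ forall (g : G) (x : A), x \in X g -> inv x \in X g.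

Definition is_alg_aut (A : naAlgType F) (f : 'End(A)) : Prop :=
  bijective f /\ {morph f : x y / namul x y}.

Definition grading_iso (A : naAlgType F) (X X' : G -> {vspace A}) : Prop :=
  exists f : 'End(A),
    is_alg_aut f /\ forall g : G, (f @: X g)%VS = X' g.

Definition inv_grading_iso (A : naAlgType F) (inv : A -> A)
    (X X' : G -> {vspace A}) : Prop :=
  exists f : 'End(A),
    [/\ is_alg_aut f, {morph f : x / inv x}
      & forall g : G, (f @: X g)%VS = X' g].

Definition is_tensor_grading (U V : vectType F) (X1 : G -> {vspace U})
    (X2 : G -> {vspace V}) (X : G -> {vspace tensor U V}) : Prop :=
  forall g : G,
    is_dsum [pred p : G * G | p.1 + p.2 == g]
      (fun p => tensv (X1 p.1) (X2 p.2)) (X g).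

End Gradings.

(* Main.v *)
(* Write C0, B0 for the trace zero elements and (x, y, z) for the associator.
   The form n((x, y, z), u) is alternating and vanishes when an argument is 1.
   Hence B is associative (its dimension is at most 4), whereas in C the
   nucleus is F1 and, by duality, the associators span C0. The skew elements of
   A = C (x) B form K = C0 (x) 1 + 1 (x) B0, and since 1 (x) B is nuclear,
   C0 (x) 1 is spanned by the associators of K while 1 (x) B0 consists of the
   k in K with (k, K, K) = 0. Both subspaces are therefore graded for every
   grading of (A, -) and invariant under every automorphism of (A, -), so the
   gradings and the isomorphisms restrict to the two factors. *)

Require Import Defs.
From HB Require Import structures.
From mathcomp Require Import all_boot all_algebra.
From mathcomp Require Import ring.

Set Implicit Arguments.
Unset Strict Implicit.
Unset Printing Implicit Defensive.

Import GRing.Theory.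
Local Open Scope ring_scope.

(** The obstacle is that a grading on A does not mention the factors, so they have to be recovered
    from the product and the involution alone. Working with trace zero elements loses nothing: the
    unit has degree 0 and is fixed by automorphisms, so F1 can be added back, and halving the trace
    splits each Hurwitz algebra as D = F1 + D0. Conversely, gradings and automorphisms of the
    factors respect the standard involutions by themselves, because of the quadratic equation x^2 =
    t(x)x - n(x)1. The nucleus of C is computed from a single associator of nonzero norm, and the
    duality is a dimension count. *)

Definition assoc (F : fieldType) (A : naAlgType F) (x y z : A) : A :=
  namul (namul x y) z - namul x (namul y z).

(** * Associators in an arbitrary algebra *)

Section Assoc.
Variables (F : fieldType) (A : naAlgType F).
Implicit Types x y z : A.

Lemma assoc_linear1 y z : linear (fun x => assoc x y z).
Proof.
move=> a u v; rewrite /assoc; do ?[rewrite linearPl /=].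
by rewrite scalerBr opprD addrACA.
Qed.

Lemma assoc_linear2 x z : linear (fun y => assoc x y z).
Proof.
move=> a u v; rewrite /assoc; do ?[rewrite linearPl /= | rewrite linearPr /=].
by rewrite scalerBr opprD addrACA.
Qed.

Lemma assoc_linear3 x y : linear (fun z => assoc x y z).
Proof.
move=> a u v; rewrite /assoc; do ?[rewrite linearPr /=].
by rewrite scalerBr opprD addrACA.
Qed.

HB.instance Definition _ x y :=
  GRing.isLinear.Build F A A *:%R (assoc x y) (@assoc_linear3 x y).
(** [assoc1] and [assoc2] put the varying argument last, so that the first and second slots of the
    associator also carry linear-map instances. *)
Definition assoc1 y z x := assoc x y z.
HB.instance Definition _ y z :=
  GRing.isLinear.Build F A A *:%R (assoc1 y z) (@assoc_linear1 y z).
Definition assoc2 x z y := assoc x y z.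
HB.instance Definition _ x z :=
  GRing.isLinear.Build F A A *:%R (assoc2 x z) (@assoc_linear2 x z).

Lemma assocD1 x y z t : assoc (x + y) z t = assoc x z t + assoc y z t.
Proof. exact: (linearD (assoc1 z t)). Qed.

Lemma assocD2 x y z t : assoc z (x + y) t = assoc z x t + assoc z y t.
Proof. exact: (linearD (assoc2 z t)). Qed.

Lemma assocD3 x y z t : assoc z t (x + y) = assoc z t x + assoc z t y.
Proof. exact: linearD. Qed.

(** Of the five bracketings of wxyz, (wx)(yz) cancels on the left and the other four occur with
    equal signs on both sides. With a nuclear argument, the identity moves that factor in and out of
    an associator. *)
Lemma teichmuller w x y z :
  assoc (namul w x) y z - assoc w (namul x y) z + assoc w x (namul y z)
  = namul w (assoc x y z) + namul (assoc w x y) z.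
Proof.
rewrite /assoc linearBr /= linearBl /=.
set p1 := namul (namul (namul w x) y) z; set p2 := namul (namul w x) _.
set p3 := namul (namul w (namul x y)) z.
set p4 := namul w (namul (namul x y) z).
set p5 := namul w (namul x _).
rewrite opprB addrAC (addrA (p1 - p2)) addrNK addrC addrACA [RHS]addrACA.
by congr (_ + _); rewrite addrC.
Qed.

End Assoc.

Section LinearLfun.
Variables (F : fieldType) (V W : vectType F) (f : V -> W) (f_lin : linear f).
Let f_linear : {linear V -> W} :=
  HB.pack f (GRing.isLinear.Build F V W *:%R f f_lin).
Definition lfun_of_linear : 'Hom(V, W) := linfun f_linear.
Lemma lfun_of_linearE x : lfun_of_linear x = f x.
Proof. by rewrite lfunE. Qed.

End LinearLfun.

Lemma span_ind (F : fieldType) (V : vectType F) (X : seq V) (P : V -> Prop) :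
  (forall a x y, P x -> P y -> P (a *: x + y)) -> P 0 ->
  (forall x, x \in X -> P x) -> forall v, v \in <<X>>%VS -> P v.
Proof.
move=> PD P0 PX v /(coord_span (X := in_tuple X)) ->.
elim/big_ind: _ => // [x y Px Py|i _]; first by rewrite -[x]scale1r; apply: PD.
by rewrite -[_ *: _]addr0; apply: PD => //; apply: PX; apply: mem_nth.
Qed.

(** * Direct sums and decompositions *)

Section DirectSums.
Variables (F : fieldType) (V : vectType F) (I : eqType).
Implicit Types (U : I -> {vspace V}) (W : {vspace V}) (s : seq I) (P : pred I).

(** [directv] is an equality of dimensions: a nonzero intersection makes the dimension drop strictly
    at the head, and the tail cannot make up for it. *)
Lemma directv_cons U i s :
  directv (\sum_(j <- i :: s) U j)%VS =
  (U i :&: \sum_(j <- s) U j == 0)%VS && directv (\sum_(j <- s) U j)%VS.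
Proof.
rewrite !directvE /= !big_cons.
have le_s : (\dim (\sum_(j <- s) U j) <= \sum_(j <- s) \dim (U j))%N.
  exact: dimv_leq_sum.
have [cap0|capN] := eqVneq (U i :&: \sum_(j <- s) U j)%VS 0%VS.
  by rewrite (dimv_disjoint_sum cap0) eqn_add2l.
apply/negbTE; rewrite neq_ltn; apply/orP; left.
rewrite (leq_trans _ (leq_add (leqnn _) le_s)) //.
rewrite (ltn_leqif (dimv_add_leqif _ _)).
by rewrite subv0.
Qed.

Lemma directv_seq_independent U s (x : I -> V) :
    directv (\sum_(i <- s) U i)%VS -> (forall i, x i \in U i) ->
  \sum_(i <- s) x i = 0 -> forall i, i \in s -> x i = 0.
Proof.
move=> + xU; elim: s => // j s IHs; rewrite directv_cons => /andP[/eqP cap0 ds].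
rewrite big_cons => /eqP; rewrite addr_eq0 => /eqP xj.
have sU : \sum_(i <- s) x i \in (\sum_(j <- s) U j)%VS.
  by elim/big_rec2: _ => [|i y Z _ yZ]; rewrite ?mem0v ?memv_add.
have xj0 : x j = 0.
  apply/eqP; rewrite -memv0 -cap0 memv_cap xU /=.
  by rewrite xj memvN.
move=> i; rewrite inE => /orP[/eqP->//|]; apply: IHs => //.
by apply/eqP; rewrite -oppr_eq0 -xj xj0.
Qed.

(** The map [p i] is the identity on [U i] and zero on the sum of other components, so these two
    spaces meet only in 0. *)
Lemma is_dsum_of_projections P U W s (p : I -> 'End(V)) :
    uniq s -> all P s ->
    (forall i j v, P i -> P j -> v \in U i ->
      p j v = if j == i then v else 0) ->
    (forall i, P i -> (U i <= W)%VS) -> (W <= \sum_(i <- s) U i)%VS ->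
  is_dsum P U W.
Proof.
move=> us Ps pE UW WU; split=> [r|v]; last first.
  split=> [vW|[r Pr]]; first by exists s => //; apply: (subvP WU).
  apply/subvP; elim: r Pr => [|i r IHr] /=; first by rewrite big_nil sub0v.
  by case/andP=> Pi Pr; rewrite big_cons subv_add UW ?IHr.
have p0 r' i v : P i -> i \notin r' -> all P r' ->
    v \in (\sum_(j <- r') U j)%VS -> p i v = 0.
  move=> Pi + + vU; elim: r' v vU => [|j r' IHr] v.
    by rewrite big_nil memv0 => /eqP->; rewrite linear0.
  rewrite big_cons => /memv_addP[x xU [y yU ->]] /=.
  rewrite inE negb_or => /andP[ij ir] /andP[Pj Pr].
  by rewrite linearD /= (pE j) // (negPf ij) add0r IHr.
elim: r => [|i r IHr].
  by rewrite directvE /= !big_nil dimv0.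
rewrite /= directv_cons => /andP[ir ur] /andP[Pi Pr]; rewrite IHr // andbT.
rewrite -subv0; apply/subvP=> v; rewrite memv_cap => /andP[vi vr].
by have := p0 _ _ _ Pi ir Pr vr; rewrite (pE i) // eqxx memv0 => ->.
Qed.

Lemma is_dsum_ind P U W (Q : V -> Prop) :
    (forall a x y, Q x -> Q y -> Q (a *: x + y)) -> Q 0 ->
    (forall i x, P i -> x \in U i -> Q x) ->
  is_dsum P U W -> forall x, x \in W -> Q x.
Proof.
move=> QD Q0 QY [_ WP] x /WP[s Ps]; elim: s x Ps => [|i s IHs] x /=.
  by rewrite big_nil memv0 => _ /eqP->.
case/andP=> Pi Ps; rewrite big_cons => /memv_addP[y yi [z zs ->]].
by rewrite -[y]scale1r; apply: QD; [apply: QY yi | apply: IHs zs].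
Qed.

End DirectSums.

Section Decompositions.
Variables (F : fieldType) (V : vectType F) (G : zmodType).
Implicit Types (X : G -> {vspace V}) (s : seq G).

(** The homogeneous projections of a decomposition. [G] may be infinite; the list [s] contains the
    finitely many degrees with nonzero component, which keeps all sums finite. *)
Definition is_projections X s (p : G -> 'End(V)) :=
  [/\ uniq s, forall g v, p g v \in X g,
      forall g h v, v \in X g -> p h v = if h == g then v else 0 &
      forall v, v = \sum_(g <- s) p g v].

Lemma decomposition_projections X : is_decomposition X ->
  exists s p, is_projections X s p.
Proof.
case=> dX sX.
have memS s1 s2 v : {subset s1 <= s2} -> v \in (\sum_(i <- s1) X i)%VS ->
    v \in (\sum_(i <- s2) X i)%VS.
  move=> sub; apply/subvP; elim: s1 sub => [|i s1 IHs] sub.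
    by rewrite big_nil sub0v.
  rewrite big_cons subv_add IHs ?andbT => [|j js]; last first.
    by apply: sub; rewrite inE js orbT.
  have: i \in s2 by apply: sub; rewrite inE eqxx.
  by move=> i2; rewrite (big_rem i) //= addvSl.
(* Each vector of a basis lies in a finite sum of components; concatenating these finite supports
   gives [s]. *)
have [s us sP] : exists2 s, uniq s & (\sum_(g <- s) X g)%VS = fullv.
  suff [s sP] : exists s, (<<vbasis {:V}>> <= \sum_(g <- s) X g)%VS.
    exists (undup s); first exact: undup_uniq.
    apply/eqP; rewrite eqEsubv subvf /= -(span_basis (vbasisP fullv)).
    apply: subv_trans sP _; apply/subvP => v; apply: memS => g.
    by rewrite mem_undup.
  elim: (tval (vbasis {:V})) => [|v r [s sP]].
    by exists [::]; rewrite span_nil sub0v.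
  have /sX[s' _ vs'] := memvf v.
  exists (s ++ s'); apply/span_subvP=> w; rewrite inE => /orP[/eqP->|wr].
    by apply: memS vs' => g; rewrite mem_cat => ->; rewrite orbT.
  apply: (memS s); first by move=> g; rewrite mem_cat => ->.
  by apply: (subvP sP); apply: memv_span.
pose p g := if g \in s then sumv_pi_for (esym sP) g else 0.
exists s, p.
have pX g v : p g v \in X g.
  by rewrite /p; case: ifP => _; rewrite ?memv_sum_pi // lfunE mem0v.
have psum v : v = \sum_(g <- s) p g v.
  rewrite -{1}(sumv_pi_uniq_sum (esym sP) (v := v)) ?filter_predT ?memvf //.
  by apply: eq_big_seq => g gs; rewrite /p gs.
split=> // g h v vg.
have delta_sum k0 r : uniq r ->
    \sum_(k <- r) (if k == k0 then v else 0) = if k0 \in r then v else 0.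
  move=> ur; rewrite -big_mkcond; case: ifP => k0r; last first.
    rewrite big_seq_cond big1 // => k /andP[kr /eqP kk0].
    by rewrite kk0 k0r in kr.
  by rewrite -big_filter filter_pred1_uniq // big_seq1.
have pN k : k \notin s -> p k v = 0 by rewrite /p => /negPf->; rewrite lfunE.
(* The degree [g] is not known to belong to [s], hence the enlarged list. Independence along it
   compares the expansion of [v] by projections with [v] itself, seen as an element of [X g]. *)
pose r := undup (g :: s).
have sum0 : \sum_(k <- r) (p k v - (if k == g then v else 0)) = 0.
  rewrite sumrB delta_sum ?undup_uniq // mem_undup inE eqxx orTb.
  rewrite /r [undup _]/= undup_id //.
  case: ifP => [gs|/negbT gs]; first by rewrite -psum subrr.
  by rewrite big_cons pN // add0r -psum subrr.
have [|hr] := boolP (h \in r); last first.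
  have: h \notin g :: s by rewrite -mem_undup.
  by rewrite inE negb_or => /andP[/negPf-> /pN].
move/(directv_seq_independent (dX r (undup_uniq _) (all_predT _)) _ sum0).
move=> E; apply/subr0_eq/E => k; rewrite memvB //.
by case: eqP => [->|]; rewrite ?mem0v.
Qed.

Lemma decomposition_of_projections X s p :
  is_projections X s p -> is_decomposition X.
Proof.
case=> us pX pE psum; apply: (@is_dsum_of_projections _ _ _ _ _ _ s p) => //.
- exact: all_predT.
- by move=> i j v _ _; apply: pE.
- by move=> i _; apply: subvf.
- apply/subvP=> v _; rewrite (psum v).
  by elim/big_rec2: _ => [|i y Z _ yZ]; rewrite ?mem0v ?memv_add.
Qed.

End Decompositions.

(** * Graded maps and tensor products of gradings *)

Section GradedMaps.
Variables (F : fieldType) (G : zmodType).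

(** A linear map that shifts degrees by [d] intertwines the projections. It is used with [d = 0] for
    the involution and for inclusions, and with other shifts for products and associators with
    homogeneous elements. *)
Lemma projection_homogeneous (V V' : vectType F) (X : G -> {vspace V})
    (X' : G -> {vspace V'}) s p s' p' (T : V -> V') d :
    linear T ->
    is_projections X s p -> is_projections X' s' p' ->
    (forall g v, v \in X g -> T v \in X' (g + d)) ->
  forall g v, p' (g + d) (T v) = T (p g v).
Proof.
move=> T_lin [us pX pE psum] [us' pX' pE' psum'] TX g v.
have TE := lfun_of_linearE T_lin.
rewrite [in LHS](psum v) [in RHS](psum v) -!TE !linear_sum.
apply: eq_bigr => h _ /=; rewrite !TE.
rewrite (pE' (h + d)) ?TX ?pX // (pE h g (p h v)) ?pX //.
have /= -> := inj_eq (addIr d) g h.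
by case: ifP; rewrite // -TE linear0.
Qed.

Section Gradings.
Variables (A : naAlgType F) (X : G -> {vspace A}).
Variables (s : seq G) (p : G -> 'End(A)).
Hypotheses (Xgr : is_grading X) (Xp : is_projections X s p).

(** Let e0 be the degree 0 component of e. For x of degree h, the degree h component of ex = x reads
    e0 x = x, so e0 is a left unit and e0 = e0 e = e. *)
Lemma grading_one e : left_id e (@namul F A) -> right_id e (@namul F A) ->
  e \in X 0.
Proof.
move=> e1 er; have [us pX pE psum] := Xp.
have e0h h x : x \in X h -> namul (p 0 e) x = x.
  move=> xh.
  have := @projection_homogeneous _ _ _ _ _ _ _ _ (namul^~ x) h _ Xp Xp.
  move=> /(_ _ _ 0 e) <-; first 1 last.
  - by move=> a u v; rewrite linearPl.
  - by move=> g v vg; apply: Xgr.2.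
  by rewrite e1 add0r (pE h) // eqxx.
have e0x x : namul (p 0 e) x = x.
  rewrite [in LHS](psum x) [in RHS](psum x) linear_sumr /=.
  by apply: eq_bigr => h _; apply: e0h (pX _ _).
by have := pX 0 e; rewrite -[p 0 e]er e0x.
Qed.

Lemma assoc_homogeneous g h k x y z : x \in X g -> y \in X h -> z \in X k ->
  assoc x y z \in X (g + (h + k)).
Proof.
move=> xg yh zk; rewrite /assoc memvB //; last by do 2?apply: Xgr.2.
by rewrite addrA; do 2?apply: Xgr.2.
Qed.

End Gradings.

End GradedMaps.

(** * Induction on tensors, tensor products of maps and of decompositions *)

Section TensorInduction.
Variables (F : fieldType) (U V : vectType F).

Lemma tensv_ind (S : {vspace U}) (T : {vspace V}) (P : tensor U V -> Prop) :
    (forall a X Y, P X -> P Y -> P (a *: X + Y)) -> P 0 ->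
    (forall u v, u \in S -> v \in T -> P (tens u v)) ->
  forall X, X \in tensv S T -> P X.
Proof.
move=> PD P0 PT X; apply: span_ind => // _ /allpairsP[[u v] [/= uS vT ->]].
by apply: PT; apply: vbasis_mem.
Qed.

Lemma tens_ind (P : tensor U V -> Prop) :
    (forall a X Y, P X -> P Y -> P (a *: X + Y)) -> P 0 ->
    (forall u v, P (tens u v)) -> forall X, P X.
Proof.
move=> PD P0 PT X; apply: (@tensv_ind fullv fullv) => //.
rewrite [X](tlift_unique idfun).
apply: memv_suml => i _; apply: memv_suml => j _.
by rewrite memvZ // mem_tensv ?memvf.
Qed.

End TensorInduction.

Section TensorMap.
Variables (F : fieldType) (U V U' V' : vectType F).

Definition tmap (f : 'Hom(U, U')) (g : 'Hom(V, V')) :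
  'Hom(tensor U V, tensor U' V') :=
  lfun_of_linear (tlift_is_linear (fun u v => tens (f u) (g v))).

Lemma tmap_tens f g u v : tmap f g (tens u v) = tens (f u) (g v).
Proof.
rewrite lfun_of_linearE tlift_tens //.
by split=> [w|w] a x y; rewrite linearP ?linearPl ?linearPr.
Qed.

End TensorMap.

Section TensorGrading.
Variables (F : fieldType) (G : zmodType) (U V : vectType F).
Variables (X1 : G -> {vspace U}) (X2 : G -> {vspace V}).
Variable X : G -> {vspace tensor U V}.

(** The maps [p1 i.1] tensor [p2 i.2] are projections onto the products of components, which makes
    their sum direct. Mere inclusions in the components of [X] are enough, since both sides
    decompose the whole space. *)
Lemma tensor_grading_intro :
    is_decomposition X1 -> is_decomposition X2 -> is_decomposition X ->
    (forall g h u v, u \in X1 g -> v \in X2 h -> tens u v \in X (g + h)) ->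
  is_tensor_grading X1 X2 X.
Proof.
move=> /decomposition_projections[s1 [p1 [us1 p1X p1E p1sum]]].
move=> /decomposition_projections[s2 [p2 [us2 p2X p2E p2sum]]].
move=> /decomposition_projections[s [p [us pX pE psum]]] XX g.
have [q qE] : exists q : G * G -> 'End(tensor U V),
    forall i u v, q i (tens u v) = tens (p1 i.1 u) (p2 i.2 v).
  by exists (fun i => tmap (p1 i.1) (p2 i.2)) => i u v; rewrite tmap_tens.
pose r := [seq (a, b) | a <- s1, b <- s2].
have subX i : (tensv (X1 i.1) (X2 i.2) <= X (i.1 + i.2)%R)%VS.
  by apply: tensv_sub => u v; apply: XX.
have qX i v : q i v \in tensv (X1 i.1) (X2 i.2).
  elim/tens_ind: v => [a x y|| u v]; rewrite ?linear0 ?mem0v //.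
    by move=> qx qy; rewrite linearP memvD ?memvZ.
  by rewrite qE mem_tensv.
have qsum v : v = \sum_(i <- r) q i v.
  elim/tens_ind: v => [a x y|| u v].
  - move=> Ex Ey; rewrite {1}Ex {1}Ey scaler_sumr -big_split.
    by apply: eq_bigr => i _; rewrite linearP.
  - by rewrite big1 // => i _; rewrite linear0.
  rewrite big_allpairs {1}(p1sum u) linear_sumlz; apply: eq_bigr => a _ /=.
  rewrite {1}(p2sum v) linear_sumr; apply: eq_bigr => b _.
  by rewrite qE.
apply: (@is_dsum_of_projections _ _ _ _ _ _ [seq i <- r | i.1 + i.2 == g] q).
- by rewrite filter_uniq // allpairs_uniq // => [[a b] [c d]].
- exact: filter_all.
- move=> i j v _ _.
  pose Q v := q j v = if j == i then v else 0.
  apply: (tensv_ind (P := Q)) => [a x y Ex Ey||u1 u2 uX vX]; rewrite /Q.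
  + by rewrite linearP /= Ex Ey; case: ifP => // _; rewrite scaler0 addr0.
  + by rewrite linear0 if_same.
  rewrite qE (p1E i.1) // (p2E i.2) // -pair_eqE /pair_eq.
  by case: eqP; case: eqP; rewrite ?linear0l ?linear0r.
- by move=> i /eqP <-.
(* Apply [p g] to the expansion of [v]: terms of total degree [g] survive, all others vanish. *)
apply/subvP => v vg; have -> : v = \sum_(i <- r | i.1 + i.2 == g) q i v.
  have vE : p g v = v by rewrite (pE g) // eqxx.
  rewrite big_mkcond -[LHS]vE [in LHS](qsum v) linear_sum.
  apply: eq_bigr => i _ /=.
  by rewrite (pE (i.1 + i.2)) ?(subvP (subX i)) // eq_sym.
rewrite -[X in X \in _]big_filter.
by elim/big_rec2: _ => [|i y Z _ yZ]; rewrite ?mem0v ?memv_add.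
Qed.

End TensorGrading.

(** * Associators in Hurwitz algebras *)

HB.instance Definition _ (F : fieldType) (A : hurwitzType F) :=
  bilinear_isBilinear.Build F A A F *%R *%R (@polar F A (@hnorm F A))
    hpolar_bilinear.

Section Hurwitz.
Variables (F : fieldType) (A : hurwitzType F).
Hypothesis one_neq0 : hone != 0 :> A.
Hypothesis char2 : 2%N \notin [pchar F].
Implicit Types (a : F) (x y z u v w : A).
Local Notation n := (@hnorm F A).
Local Notation b := (polar (@hnorm F A)).
Local Notation "x · y" := (namul x y) (at level 40, left associativity).

Lemma polarC x y : b x y = b y x.
Proof. by rewrite /polar [x + y]addrC addrAC. Qed.

Lemma hurwitz_ext x y : (forall w, b x w = b y w) -> x = y.
Proof.
move=> H; apply/eqP; rewrite -subr_eq0; apply/eqP.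
by apply: hpolar_nondegenerate => w; rewrite linearBl /= H subrr.
Qed.

Lemma hnorm_add x y : n (x + y) = n x + n y + b x y.
Proof. by rewrite /polar; ring. Qed.

(** By multiplicativity n(1) is idempotent in F; if it were 0, then n and its polar form would
    vanish, contradicting nondegeneracy at 1. *)
Lemma hnorm1 : n hone = 1.
Proof.
have idem : n hone * n hone = n hone by rewrite -hnormM hmul1.
have [n1|/mulfI] := eqVneq (n hone) 0; last by apply; rewrite mulr1.
case/eqP: one_neq0; apply: hpolar_nondegenerate => y.
have n0 z : n z = 0 by rewrite -[z]hmul1 hnormM n1 mul0r.
by rewrite /polar !n0 !subr0.
Qed.

Lemma two_neq0 : 2%:R != 0 :> F.
Proof. by move: char2; rewrite !inE /=. Qed.

Lemma polarxx x : b x x = 2%:R * n x.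
Proof.
by rewrite /polar -[x + x]mulr2n -scaler_nat hnormZ; ring.
Qed.

Lemma polar_namull x y z : b (x · y) (x · z) = n x * b y z.
Proof. by rewrite /polar -linearDr !hnormM; ring. Qed.

Lemma polar_namulr x y z : b (x · y) (z · y) = b x z * n y.
Proof. by rewrite /polar -linearDl !hnormM; ring. Qed.

(** Linearization in x of n(xy, xz) = n(x) n(y, z). Setting one argument to 1 shows below that
    multiplication by x has multiplication by its conjugate as adjoint. *)
Lemma polar_namul_exch x w y z :
  b (x · y) (w · z) + b (w · y) (x · z) = b x w * b y z.
Proof.
have := polar_namull (x + w) y z; rewrite hnorm_add !linearDl /= !linearDr /=.
rewrite !polar_namull => H; apply: (addrI (n x * b y z + n w * b y z)).
by move: H; rewrite !mulrDl => <-; ring.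
Qed.

Lemma polar_hconjl x y z : b (x · y) z = b y (hconj x · z).
Proof.
rewrite /hconj linearBl /= linearZl_LR /= hmul1 linearBr /= linearZr_LR /=.
by rewrite -(polar_namul_exch x hone) !hmul1; ring.
Qed.

Lemma polar_hconjr x y z : b (x · y) z = b x (z · hconj y).
Proof.
rewrite /hconj linearBr /= linearZr_LR /= hmulr1 linearBr /= linearZr_LR /=.
have := polar_namul_exch x z y hone; rewrite !hmulr1 => H.
by rewrite mulrC -H (polarC x); ring.
Qed.

Lemma polar11 : b hone hone = 2%:R.
Proof. by rewrite polarxx hnorm1 mulr1. Qed.

Lemma polar_hconj1 x : b (hconj x) hone = b x hone.
Proof. by rewrite /hconj linearBl /= linearZl_LR /= polar11; ring. Qed.

Lemma hconjK : involutive (@hconj F A).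
Proof.
by move=> x; rewrite {1}/hconj polar_hconj1 /hconj opprB addrC addrNK.
Qed.

Lemma namul_hconjl x y : hconj x · (x · y) = n x *: y.
Proof.
apply: hurwitz_ext => w; rewrite polar_hconjl hconjK polar_namull.
by rewrite linearZl_LR.
Qed.

Lemma namul_hconjr x y : (y · x) · hconj x = n x *: y.
Proof.
apply: hurwitz_ext => w; rewrite polar_hconjr hconjK polar_namulr.
by rewrite linearZl_LR mulrC.
Qed.

Lemma hurwitz_quadratic x : x · x = b x hone *: x - n x *: hone.
Proof.
have := namul_hconjl x hone; rewrite hmulr1 => <-.
by rewrite /hconj linearBl /= linearZl_LR /= hmul1 opprB addrC addrNK.
Qed.

Lemma assocxx x y : assoc x x y = 0.
Proof.
rewrite /assoc hurwitz_quadratic linearBl /= !linearZl_LR /= hmul1.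
rewrite -namul_hconjl /hconj linearBl /= linearZl_LR /= hmul1.
by rewrite subKr subrr.
Qed.

Lemma assoc_xx x y : assoc y x x = 0.
Proof.
rewrite /assoc hurwitz_quadratic linearBr /= !linearZr_LR /= hmulr1.
rewrite -namul_hconjr /hconj linearBr /= linearZr_LR /= hmulr1.
by rewrite subKr subrr.
Qed.

Lemma assoc_swap12 x y z : assoc x y z = - assoc y x z.
Proof.
apply/eqP; rewrite -addr_eq0; have := assocxx (x + y) z.
by rewrite assocD1 !assocD2 !assocxx add0r addr0 => ->.
Qed.

Lemma assoc_swap23 x y z : assoc x y z = - assoc x z y.
Proof.
apply/eqP; rewrite -addr_eq0; have := assoc_xx (y + z) x.
by rewrite assocD3 !assocD2 !assoc_xx add0r addr0 addrC => ->.
Qed.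

Lemma assoc_1l y z : assoc hone y z = 0.
Proof. by rewrite /assoc !hmul1 subrr. Qed.

Lemma assoc_1m y z : assoc y hone z = 0.
Proof. by rewrite /assoc hmul1 hmulr1 subrr. Qed.

Lemma assoc_1r y z : assoc y z hone = 0.
Proof. by rewrite /assoc !hmulr1 subrr. Qed.

Lemma assoc_hconj2 x y z : assoc x (hconj y) z = - assoc x y z.
Proof.
rewrite -[LHS]/(assoc2 x z _) /hconj linearB linearZ /= /assoc2 assoc_1m.
by rewrite scaler0 sub0r.
Qed.

Lemma assoc_hconj3 x y z : assoc x y (hconj z) = - assoc x y z.
Proof. by rewrite /hconj linearB linearZ /= assoc_1r scaler0 sub0r. Qed.

Lemma hconjM x y : hconj (x · y) = hconj y · hconj x.
Proof.
apply: hurwitz_ext => u; rewrite ![b _ u]polarC.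
transitivity (b (u · (x · y)) hone); first by rewrite polar_hconjr hmul1.
by rewrite polar_hconjl hmulr1 polar_hconjl -polar_hconjr polar_hconjl.
Qed.

(** Adjointness carries y and z to the other side and conjugates both; the two signs cancel.
    Together with alternativity, this extends the skew symmetry of the associator to the fourth
    argument u. *)
Lemma polar_assoc x y z u : b (assoc x y z) u = b (assoc u z y) x.
Proof.
rewrite /assoc !linearBl /= [b (x · y · z) u]polar_hconjr.
rewrite [b (x · y) _]polar_hconjr [b (x · _) _]polar_hconjr hconjM.
rewrite -linearBr /= -/(assoc u (hconj z) (hconj y)).
by rewrite assoc_hconj2 assoc_hconj3 opprK polarC /assoc linearBl.
Qed.

Lemma assoc_dim4 : (\dim {:A} <= 4)%N -> forall x y z, assoc x y z = 0.
Proof.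
move=> dimA x y z; apply: hurwitz_ext => u; rewrite linear0l.
(* Five vectors in dimension at most 4 are dependent, while the form vanishes as soon as two
   arguments agree or one is 1. *)
have: ~~ free [:: x; y; z; u; hone].
  apply/negP; rewrite /free => /eqP E.
  have := dimvS (subvf <<[:: x; y; z; u; hone]>>).
  by rewrite E /= => /leq_trans/(_ dimA).
have phi_xx x1 x2 x3 : b (assoc x1 x2 x3) x3 = 0.
  by rewrite polar_assoc assocxx linear0l.
have phi_x2 x1 x2 x3 : b (assoc x1 x2 x3) x2 = 0.
  by rewrite assoc_swap23 linearNl /= phi_xx oppr0.
have phi_x1 x1 x2 x3 : b (assoc x1 x2 x3) x1 = 0.
  by rewrite assoc_swap12 linearNl /= phi_x2 oppr0.
have assoc_x_x x1 x2 : assoc x1 x2 x1 = 0.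
  by rewrite assoc_swap12 assoc_xx oppr0.
have lin1 : forall a x1 x2, b (assoc x1 y z) u = 0 -> b (assoc x2 y z) u = 0 ->
  b (assoc (a *: x1 + x2) y z) u = 0.
  by move=> a x1 x2 E1 E2; rewrite assoc_linear1 linearPl /= E1 E2 mulr0 addr0.
have lin2 : forall a x1 x2, b (assoc x x1 z) u = 0 -> b (assoc x x2 z) u = 0 ->
  b (assoc x (a *: x1 + x2) z) u = 0.
  by move=> a x1 x2 E1 E2; rewrite assoc_linear2 linearPl /= E1 E2 mulr0 addr0.
have lin3 : forall a x1 x2, b (assoc x y x1) u = 0 -> b (assoc x y x2) u = 0 ->
  b (assoc x y (a *: x1 + x2)) u = 0.
  by move=> a x1 x2 E1 E2; rewrite assoc_linear3 linearPl /= E1 E2 mulr0 addr0.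
have lin4 : forall a x1 x2, b (assoc x y z) x1 = 0 -> b (assoc x y z) x2 = 0 ->
  b (assoc x y z) (a *: x1 + x2) = 0.
  by move=> a x1 x2 E1 E2; rewrite linearPr /= E1 E2 mulr0 addr0.
(* Some entry lies in the span of the later ones. The form is linear in that slot and zero on each
   later entry. *)
rewrite !free_cons !negb_and !negbK => /or4P[| | |/or3P[| |]].
- apply: (span_ind lin1).
    by rewrite [assoc 0 y z](linear0 (assoc1 y z)) linear0l.
  move=> v; rewrite !inE => /or4P[] /eqP->.
  + by rewrite assocxx linear0l.
  + by rewrite assoc_x_x linear0l.
  + by rewrite phi_x1.
  + by rewrite assoc_1l linear0l.
- apply: (span_ind lin2).
    by rewrite [assoc x 0 z](linear0 (assoc2 x z)) linear0l.
  move=> v; rewrite !inE => /or3P[] /eqP->.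
  + by rewrite assoc_xx linear0l.
  + by rewrite phi_x2.
  + by rewrite assoc_1m linear0l.
- apply: (span_ind lin3); rewrite ?linear0 ?linear0l //.
  move=> v; rewrite !inE => /orP[] /eqP->.
  + by rewrite phi_xx.
  + by rewrite assoc_1r linear0l.
- apply: (span_ind lin4); rewrite ?linear0r //.
  move=> v; rewrite !inE => /eqP->.
  by rewrite polar_assoc assoc_1l linear0l.
- by rewrite span_nil memv0 (negPf one_neq0).
- by rewrite nil_free.
Qed.

(** * Orthogonal families of anisotropic vectors *)

Lemma exists_polar_neq0 x : x != 0 -> exists y, b x y != 0.
Proof.
move=> x0; have [/existsP[i ?]|/existsPn H] :=
  boolP [exists i : 'I_(\dim {:A}), b x (vbasis {:A})`_i != 0].
  by exists (vbasis {:A})`_i.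
case/eqP: x0; apply: hpolar_nondegenerate => y.
apply: (span_ind (X := vbasis {:A}) (P := fun y => b x y = 0)).
- by move=> a y1 y2 E1 E2; rewrite linearPr /= E1 E2 mulr0 addr0.
- exact: linear0r.
- move=> w /(nthP 0)[i]; rewrite size_tuple => lti <-.
  by have := H (Ordinal lti); rewrite negbK => /eqP.
- by rewrite (span_basis (vbasisP _)) memvf.
Qed.

Definition orthogonal_anisotropic (s : seq A) :=
  pairwise (fun x y => b x y == 0) s && all (fun x => n x != 0) s.

Lemma polar_span0 s x y :
  (forall w, w \in s -> b x w = 0) -> y \in <<s>>%VS -> b x y = 0.
Proof.
move=> H; apply: (span_ind (P := fun y => b x y = 0)); rewrite ?linear0r //.
by move=> a y1 y2 E1 E2; rewrite linearPr /= E1 E2 mulr0 addr0.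
Qed.

Lemma orthogonal_residue s x : orthogonal_anisotropic s ->
  exists2 y, y \in <<s>>%VS & forall w, w \in s -> b (x - y) w = 0.
Proof.
rewrite /orthogonal_anisotropic; elim: s => [|w s IHs] /=.
  by move=> _; exists 0; rewrite ?mem0v.
case/andP=> /andP[/allP ws ps] /andP[nw ns].
have [|y ys yP] := IHs; first by rewrite ps.
have wy : b w y = 0 by apply: polar_span0 ys => v /ws/eqP.
(* One Gram-Schmidt step; b w w = 2 n w is invertible as w is anisotropic and 2 is nonzero. *)
exists (y + (b x w / b w w) *: w).
  rewrite span_cons addrC; apply: memv_add => //.
  by apply: memvZ; apply: memv_line.
have bww : b w w != 0 by rewrite polarxx mulf_neq0 // two_neq0.
move=> v; rewrite inE opprD addrA linearBl /= linearZl_LR /= => /orP[/eqP->|vs].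
  by rewrite linearBl /= [b y w]polarC wy subr0 divfK // subrr.
by rewrite yP // sub0r (eqP (ws _ vs)) mulr0 oppr0.
Qed.

(** The residue x' of a vector outside the span may be isotropic. Nondegeneracy then gives a second
    residue z' with b x' z' nonzero, and since n(x' + z') = n x' + n z' + b x' z', one of x', z', x'
    + z' is anisotropic. *)
Lemma exists_anisotropic_orthogonal s :
    orthogonal_anisotropic s -> (size s < \dim {:A})%N ->
  exists2 v, n v != 0 & forall w, w \in s -> b v w = 0.
Proof.
move=> os szs; have /subvPn[x _ xs]: ~~ ({:A} <= <<s>>)%VS.
  apply: contraTN szs => /dimvS; rewrite -leqNgt => H.
  exact: leq_trans H (dim_span _).
have [y ys yP] := orthogonal_residue x os.
have x'0 : x - y != 0 by apply: contraNneq xs => /subr0_eq->.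
have [z xz] := exists_polar_neq0 x'0.
have [t ts tP] := orthogonal_residue z os.
have xt : b (x - y) (z - t) != 0.
  by rewrite linearBr /= (polar_span0 yP ts) subr0.
have [n1|n1] := eqVneq (n (x - y)) 0; last by exists (x - y).
have [n2|n2] := eqVneq (n (z - t)) 0; last by exists (z - t).
exists ((x - y) + (z - t)); first by rewrite hnorm_add n1 n2 !add0r.
by move=> w ws; rewrite linearDl /= yP // tP // addr0.
Qed.

Lemma hconj_trace0 x : b x hone = 0 -> hconj x = - x.
Proof. by rewrite /hconj => ->; rewrite scale0r sub0r. Qed.

(** Orthogonality makes xy trace zero, so its conjugate is -xy; but this conjugate is also (-y)(-x)
    = yx. *)
Lemma namul_anticomm x y : b x hone = 0 -> b y hone = 0 -> b x y = 0 ->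
  x · y = - (y · x).
Proof.
move=> x1 y1 xy; have: b (x · y) hone = 0.
  by rewrite polar_hconjr // hmul1 (hconj_trace0 y1) linearNr /= xy oppr0.
move/hconj_trace0; rewrite hconjM // !hconj_trace0 // linearNl /= linearNr /=.
by rewrite opprK => ->; rewrite opprK.
Qed.

(** * The nucleus in dimension greater than 4 *)

Section Nuclear.
Variable u : A.
Hypothesis u_nuc : forall y z, assoc u y z = 0.

Let u_nuc2 y z : assoc y u z = 0.
Proof. by rewrite assoc_swap12 // u_nuc oppr0. Qed.
Let u_nuc3 y z : assoc y z u = 0.
Proof. by rewrite assoc_swap23 // u_nuc2 oppr0. Qed.

(** With the Teichmuller identity and alternativity: (x,y,z)u = (y,z,x)u = (y,z,xu) = (xu,y,z) =
    (x,uy,z) = -(uy,x,z) = -u(y,x,z) = u(x,y,z). *)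
Lemma nuclear_comm_assoc x y z : u · assoc x y z = assoc x y z · u.
Proof.
have mull x1 y1 z1 : assoc (u · x1) y1 z1 = u · assoc x1 y1 z1.
  by have := teichmuller u x1 y1 z1; rewrite !u_nuc linear0l subr0 !addr0.
have mulr w1 x1 y1 : assoc w1 x1 (y1 · u) = assoc w1 x1 y1 · u.
  by have := teichmuller w1 x1 y1 u; rewrite !u_nuc3 linear0r subr0 !add0r.
have mid x1 y1 z1 : assoc (x1 · u) y1 z1 = assoc x1 (u · y1) z1.
  have := teichmuller x1 u y1 z1.
  rewrite u_nuc u_nuc2 u_nuc2 linear0r linear0l !addr0.
  by move/subr0_eq.
have rot x1 y1 z1 : assoc x1 y1 z1 = assoc y1 z1 x1.
  by rewrite assoc_swap12 // assoc_swap23 // opprK.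
rewrite [in RHS]rot -mulr -[RHS]rot mid [RHS]assoc_swap12 // mull.
by rewrite assoc_swap12 // linearNr.
Qed.

End Nuclear.

(* For i, j, k trace zero, pairwise orthogonal and with k orthogonal to ij, one
   has i(jk) = - (ij)k, so that (i, j, k) = 2(ij)k. *)
Lemma exists_anisotropic_assoc : (4 < \dim {:A})%N ->
  exists i j k, n (assoc i j k) != 0.
Proof.
move=> dimA.
have n1 : n hone != 0 by rewrite hnorm1 // oner_eq0.
have [||i ni /(_ hone)] := @exists_anisotropic_orthogonal [:: hone].
- by rewrite /orthogonal_anisotropic /= n1.
- exact: leq_trans dimA.
rewrite inE eqxx => /(_ isT) i1.
have [||j nj jP] := @exists_anisotropic_orthogonal [:: hone; i].
- by rewrite /orthogonal_anisotropic /= n1 ni polarC i1 eqxx.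
- exact: leq_trans dimA.
have j1 : b j hone = 0 by apply: jP; rewrite !inE eqxx.
have ji : b j i = 0 by apply: jP; rewrite !inE eqxx orbT.
have ij1 : b (i · j) hone = 0.
  rewrite polar_hconjr // hmul1 (hconj_trace0 j1) linearNr /= polarC ji.
  exact: oppr0.
have iji : b (i · j) i = 0.
  by rewrite -{2}[i]hmulr1 polar_namull // j1 mulr0.
have ijj : b (i · j) j = 0.
  by rewrite -{2}[j]hmul1 polar_namulr // i1 mul0r.
have nij : n (i · j) != 0 by rewrite hnormM mulf_neq0.
have [||v nv vP] := @exists_anisotropic_orthogonal [:: hone; i; j; i · j].
- rewrite /orthogonal_anisotropic /= n1 ni nj nij ![b hone _]polarC i1 j1 ij1.
  by rewrite ![b i _]polarC ji iji [b j (_ · _)]polarC ijj eqxx.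
- exact: dimA.
have v1 : b v hone = 0 by apply: vP; rewrite !inE eqxx.
have vi : b v i = 0 by apply: vP; rewrite !inE eqxx !orbT.
have vj : b v j = 0 by apply: vP; rewrite !inE eqxx !orbT.
have vij : b v (i · j) = 0 by apply: vP; rewrite !inE eqxx !orbT.
exists i, j, v.
suff -> : assoc i j v = 2%:R *: (i · j · v).
  rewrite hnormZ hnormM !mulf_neq0 //; exact: two_neq0.
(* Since iv = -vi, the first products of (i,v,j) = -(v,i,j) cancel, and the remaining ones give this
   equation. *)
have E : i · (v · j) = - (v · (i · j)).
  have := assoc_swap12 i v j.
  rewrite /assoc (namul_anticomm v1 i1 vi) opprB linearNl /= opprK.
  by rewrite addrC => /addIr <-; rewrite opprK.
rewrite /assoc (namul_anticomm j1 v1) 1?polarC // linearNr /= E.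
by rewrite opprK (namul_anticomm v1 ij1 vij) opprK scaler_nat mulr2n.
Qed.

(* A trace zero nuclear u commutes with d = (i, j, k) and is orthogonal to it,
   which also makes it anticommute with d; so ud = 0 with d invertible. *)
Lemma nuclear_trace0 : (4 < \dim {:A})%N -> forall u,
  (forall y z, assoc u y z = 0) -> b u hone = 0 -> u = 0.
Proof.
move=> /exists_anisotropic_assoc[i [j [k nd]]] u u_nuc u1.
have d1 : b (assoc i j k) hone = 0 by rewrite polar_assoc // assoc_1l linear0l.
have ud : b u (assoc i j k) = 0 by rewrite polarC polar_assoc // u_nuc linear0l.
have: u · assoc i j k = 0.
  have := namul_anticomm u1 d1 ud; rewrite -nuclear_comm_assoc //.
  move/eqP; rewrite -addr_eq0 -mulr2n -scaler_nat scaler_eq0.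
  by rewrite (negPf two_neq0) => /eqP.
move/(congr1 (fun x => x · hconj (assoc i j k))); rewrite namul_hconjr //.
by rewrite linear0l => /eqP; rewrite scaler_eq0 (negPf nd) => /eqP.
Qed.

(** * Trace zero elements and the span of the associators *)

Lemma trace_linear : linear (fun x : A => b x hone : F^o).
Proof. by move=> a x y; rewrite linearPl. Qed.

Definition trace0 : {vspace A} := lker (lfun_of_linear trace_linear).

Lemma mem_trace0 x : (x \in trace0) = (b x hone == 0).
Proof. by rewrite memv_ker lfun_of_linearE. Qed.

Lemma trace0_decomp x : exists a x0, x0 \in trace0 /\ x = a *: hone + x0.
Proof.
exists (b x hone / 2%:R), (x - (b x hone / 2%:R) *: hone).
split; last by rewrite addrC addrNK.
rewrite mem_trace0 linearBl /= linearZl_LR /= polar11 divfK ?subrr //.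
Qed.

(** The associators lie in D, the trace zero part of W. An element orthogonal to D is nuclear by
    [polar_assoc], hence a scalar. So the pairing map [Psi] with a basis of D has kernel of
    dimension at most 1, and rank-nullity gives dim D >= dim A - 1 >= dim [trace0]. *)
Lemma trace0_sub_assoc (W : {vspace A}) : (4 < \dim {:A})%N ->
  (forall x y z, assoc x y z \in W) -> (trace0 <= W)%VS.
Proof.
move=> dimA WP; pose D := (W :&: trace0)%VS.
have DP x y z : assoc x y z \in D.
  by rewrite memv_cap WP mem_trace0 polar_assoc // assoc_1l linear0l eqxx.
pose psi u : 'rV[F]_(\dim D) := \row_i b (vbasis D)`_i u.
have psi_lin : linear psi.
  by move=> a u v; apply/rowP=> i; rewrite !mxE linearPr.
pose Psi := lfun_of_linear psi_lin.
have kerPsi : (lker Psi <= <[hone : A]>)%VS.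
  apply/subvP => u; rewrite memv_ker lfun_of_linearE => /eqP/rowP psi0.
  have Du w : w \in D -> b u w = 0.
    rewrite -[D](span_basis (vbasisP D)); apply: polar_span0 => x.
    move=> /(nthP 0)[i]; rewrite size_tuple => lti <-.
    by have := psi0 (Ordinal lti); rewrite !mxE polarC.
  have u_nuc y z : assoc u y z = 0.
    apply: hurwitz_ext => x; rewrite linear0l polar_assoc //.
    by rewrite polarC Du.
  have [a [u0 [u0t uE]]] := trace0_decomp u.
  suff u00 : u0 = 0 by rewrite uE u00 addr0 memvZ ?memv_line.
  apply: nuclear_trace0 => // [y z|]; last by apply/eqP; rewrite -mem_trace0.
  have := u_nuc y z; rewrite uE assoc_linear1.
  by rewrite assoc_1l // scaler0 add0r.
have := limg_ker_dim Psi fullv; rewrite capfv => dimE.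
have dimK : (\dim (lker Psi) <= 1)%N.
  by apply: leq_trans (dimvS kerPsi) _; rewrite dim_vline; case: eqP.
have dimI : (\dim (limg Psi) <= \dim D)%N.
  apply: leq_trans (dimvS (subvf _)) _; rewrite dimvf /dim /=.
  by rewrite mul1n.
have dimT : (\dim trace0 < \dim {:A})%N.
  rewrite ltn_neqAle dimvS ?subvf // andbT dimv_leqif_sup ?subvf //.
  apply/negP=> /subvP/(_ hone (memvf _)); rewrite mem_trace0 polar11.
  by rewrite (negPf two_neq0).
suff /eqP <- : D == trace0 by apply: capvSl.
rewrite eqEdim capvSr /= -ltnS (leq_trans dimT) // -dimE.
exact: leq_add dimK dimI.
Qed.

(* For x of degree g != 0, comparing the components of degree g in
   x^2 = t(x) x - n(x) 1 gives t(x) x = 0. *)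
Lemma hurwitz_grading_hconj (G : zmodType) (X : G -> {vspace A}) g x :
  is_grading X -> x \in X g -> hconj x \in X g.
Proof.
move=> Xgr; have [s [p Xp]] := decomposition_projections Xgr.1.
have one0 := grading_one Xgr Xp (@hmul1 F A) (@hmulr1 F A).
have [us pX pE psum] := Xp.
have [->|g0] := eqVneq g 0 => xg; first by rewrite memvB // memvZ.
suff x1 : b x hone = 0 by rewrite hconj_trace0 // memvN.
have := congr1 (p g) (hurwitz_quadratic x).
rewrite linearB !linearZ /= (pE _ _ _ (Xgr.2 _ _ _ _ xg xg)) (pE _ _ _ xg).
rewrite (pE _ _ _ one0) eqxx (negPf g0) oppr0 scaler0 addr0 -{1}[g]addr0.
have /= -> := inj_eq (addrI g) 0 g; rewrite eq_sym (negPf g0).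
move/esym/eqP; rewrite scaler_eq0 => /orP[/eqP//|/eqP->].
exact: linear0l.
Qed.

Lemma alg_aut_one (A' : naAlgType F) (f : 'End(A')) e :
    left_id e (@namul F A') -> right_id e (@namul F A') -> is_alg_aut f ->
  f e = e.
Proof.
move=> el er [[f' fK f'K] fM].
by have := fM e (f' e); rewrite el f'K er => <-.
Qed.

(** It suffices that f preserves the trace t. Comparing the quadratic equation of f x with the image
    of that of x gives (t(f x) - t(x)) f x = (n(f x) - n(x)) 1. If the traces differed, f x would be
    a scalar, so x = f x, a contradiction. *)
Lemma alg_aut_hconj (f : 'End(A)) x : is_alg_aut f -> f (hconj x) = hconj (f x).
Proof.
move=> faut; have f1 := alg_aut_one (@hmul1 F A) (@hmulr1 F A) faut.
have [[f' fK f'K] fM] := faut.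
rewrite /hconj linearB linearZ /= f1; congr (_ *: _ - _).
have := congr1 f (hurwitz_quadratic x).
rewrite fM hurwitz_quadratic // linearB !linearZ /= f1 scalerN.
move/eqP; rewrite subr_eq => /eqP E.
apply/eqP; rewrite eq_sym -subr_eq0; apply/negPn/negP => t_neq.
have : (b (f x) hone - b x hone) *: f x = (n (f x) - n x) *: hone.
  have sc (c d : F) (v : A) : (c - d) *: v = c *: v - d *: v.
    exact: scalerBl.
  rewrite (sc (b (f x) hone)) (sc (n (f x))) E -[X in X - _]addrA.
  by rewrite [X in X - _]addrC addrK addrC scalerN.
move/(canRL (scalerK t_neq)); rewrite scalerA => fxE.
have xE : x = f x by apply: (can_inj fK); rewrite [in RHS]fxE linearZ /= f1.
by rewrite -xE subrr eqxx in t_neq.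
Qed.

End Hurwitz.

(** * Restriction of gradings and isomorphisms along a retract *)

Section Retract.
Variables (F : fieldType) (G : zmodType) (A' A : naAlgType F).
Variables (I : 'Hom(A', A)) (E : 'Hom(A, A')).
Hypotheses (EI : cancel I E) (IM : {morph I : x y / namul x y}).

Lemma preim_grading (X : G -> {vspace A}) s p :
    is_grading X -> is_projections X s p ->
    (forall g c, p g (I c) \in limg I) ->
  is_grading (fun g => I @^-1: X g)%VS.
Proof.
move=> Xgr [us pX pE psum] pI; have IE v : v \in limg I -> I (E v) = v.
  by case/memv_imgP=> c _ ->; rewrite EI.
split; last first.
  by move=> g h x y; rewrite -!memv_preim IM; apply: Xgr.2.
apply: (@decomposition_of_projections _ _ _ _ s (fun g => E \o (p g \o I))%VF).
split=> // [g v|g h v|v].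
- by rewrite -memv_preim !comp_lfunE IE.
- rewrite -memv_preim !comp_lfunE => /pE->.
  by case: ifP; rewrite ?EI ?linear0.
- rewrite -[LHS]EI [in LHS](psum (I v)) linear_sum.
  by apply: eq_bigr => g _; rewrite !comp_lfunE.
Qed.

Lemma preim_grading_iso (X X' : G -> {vspace A}) (X1 X1' : G -> {vspace A'})
    (f : 'End(A)) :
    is_alg_aut f -> (forall g, (f @: X g)%VS = X' g) ->
    (forall c, f (I c) \in limg I) ->
    (forall g, X1 g = I @^-1: X g)%VS -> (forall g, X1' g = I @^-1: X' g)%VS ->
  grading_iso X1 X1'.
Proof.
move=> [[f' fK f'K] fM] fX fI X1E X1'E.
pose f1 := (E \o (f \o I))%VF.
have If1 c : I (f1 c) = f (I c).
  by rewrite !comp_lfunE; case/memv_imgP: (fI c) => c' _ ->; rewrite EI.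
have f1_inj : injective f1.
  by move=> c d /(congr1 I); rewrite !If1 => /(can_inj fK)/(can_inj EI).
(* In finite dimension the injective endomorphism [f1] is bijective. *)
have f1_ker : lker f1 == 0%VS by apply/lker0P.
have f1K := lker0_lfunK f1_ker; have f1'K := lker0_lfunVK f1_ker.
exists f1; split.
  split; first by exists (f1^-1)%VF.
  by move=> x y; apply: (can_inj EI); rewrite If1 !IM fM !If1.
move=> g; apply/vspaceP=> c; rewrite X1E X1'E -memv_preim -fX.
apply/memv_imgP/memv_imgP=> -[d].
  rewrite -memv_preim => dX ->; exists (I d) => //; exact: If1.
rewrite -[c]f1'K If1 => dX /(can_inj fK) Ed.
by exists ((f1^-1)%VF c) => //; rewrite -memv_preim Ed.
Qed.

End Retract.

(** If I c has degree g, then I c = p g (I c) = I (p1 g c), so c = p1 g c. Hence a decomposition of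
    the smaller space that is compatible with [X] is determined by [X]. *)
Lemma preim_component (F : fieldType) (G : zmodType) (V' V : vectType F)
    (I : 'Hom(V', V)) (X : G -> {vspace V}) (X1 : G -> {vspace V'}) :
    injective I -> is_decomposition X -> is_decomposition X1 ->
    (forall g c, c \in X1 g -> I c \in X g) ->
  forall g, X1 g = (I @^-1: X g)%VS.
Proof.
move=> I_inj /decomposition_projections[s [p Xp]].
move=> /decomposition_projections[s1 [p1 X1p]] XI g.
apply/vspaceP=> c; rewrite -memv_preim; apply/idP/idP; first exact: XI.
have [_ _ pE _] := Xp; have [_ p1X _ _] := X1p.
move/(pE _ g); rewrite eqxx -{1}[g]addr0.
rewrite (projection_homogeneous (T := I) _ X1p Xp).
- by move/I_inj <-.
- exact: linearP.
- by move=> h v vh; rewrite addr0 XI.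
Qed.

(** * Skew elements of a tensor product of Hurwitz algebras *)

Section TensorHurwitz.
Variables (F : fieldType) (C B : hurwitzType F).
Hypothesis char2 : 2%N \notin [pchar F].
Hypotheses (C1 : hone != 0 :> C) (B1 : hone != 0 :> B).
Hypotheses (Bassoc : forall x y z : B, assoc x y z = 0).
Hypothesis dimC : (4 < \dim {:C})%N.
Local Notation A := (tensor C B).
Local Notation e1 := (tens (hone : C) (hone : B)).

Let twoF := two_neq0 char2.

Lemma tmul1 : left_id e1 (@namul F A).
Proof.
elim/tens_ind => [a X Y E1 E2||c b]; rewrite ?linear0r //.
  by rewrite linearPr /= E1 E2.
by rewrite namul_tens !hmul1.
Qed.

Lemma tmulr1 : right_id e1 (@namul F A).
Proof.
elim/tens_ind => [a X Y E1 E2||c b]; rewrite ?linear0l //.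
  by rewrite linearPl /= E1 E2.
by rewrite namul_tens !hmulr1.
Qed.

Definition inj1 : 'Hom(C, A) :=
  lfun_of_linear ((@tens_is_bilinear F C B).1 hone).
Definition inj2 : 'Hom(B, A) :=
  lfun_of_linear ((@tens_is_bilinear F C B).2 hone).
Lemma inj1E c : inj1 c = tens c hone.
Proof. exact: lfun_of_linearE. Qed.

Lemma inj2E b : inj2 b = tens hone b.
Proof. exact: lfun_of_linearE. Qed.

(** Normalized to take the value 1 at the unit, so that [proj1] and [proj2] below are retractions of
    [inj1] and [inj2]. *)
Definition half_trace (D : hurwitzType F) (x : D) : F :=
  polar (@hnorm F D) x hone / 2%:R.

Lemma half_traceP (D : hurwitzType F) a (x y : D) :
  half_trace (a *: x + y) = a * half_trace x + half_trace y.
Proof. by rewrite /half_trace linearPl /= mulrDl mulrA. Qed.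

Definition proj1 : 'Hom(A, C) := lfun_of_linear
  (tlift_is_linear (fun (c : C) (b : B) => half_trace b *: c)).
Definition proj2 : 'Hom(A, B) := lfun_of_linear
  (tlift_is_linear (fun (c : C) (b : B) => half_trace c *: b)).

Lemma proj1E c b : proj1 (tens c b) = half_trace b *: c.
Proof.
rewrite lfun_of_linearE tlift_tens //; split=> [z|z] a x y.
  by rewrite /= scalerDr !scalerA mulrC.
by rewrite /= half_traceP scalerDl scalerA.
Qed.

Lemma proj2E c b : proj2 (tens c b) = half_trace c *: b.
Proof.
rewrite lfun_of_linearE tlift_tens //; split=> [z|z] a x y.
  by rewrite /= half_traceP scalerDl scalerA.
by rewrite /= scalerDr !scalerA mulrC.
Qed.

Lemma inj1K : cancel inj1 proj1.
Proof.
by move=> c; rewrite inj1E proj1E /half_trace polar11 // divff // scale1r.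
Qed.

Lemma inj2K : cancel inj2 proj2.
Proof.
by move=> b; rewrite inj2E proj2E /half_trace polar11 // divff // scale1r.
Qed.

Lemma inj1M : {morph inj1 : x y / namul x y}.
Proof. by move=> x y; rewrite !inj1E namul_tens hmul1. Qed.

Lemma inj2M : {morph inj2 : x y / namul x y}.
Proof. by move=> x y; rewrite !inj2E namul_tens hmul1. Qed.

Lemma tconj_linear : linear (@tconj F C B).
Proof. exact: tlift_is_linear. Qed.

Definition tskew (X : A) := tconj X = - X.

(** Write c and b as scalar plus trace zero part c0, b0. In c tensor b, the scalar term and c0
    tensor b0 are symmetric and cancel; the two mixed terms are skew and double. For skew X the left
    side is 2X, which yields the description of K. *)
Lemma subr_tconj X : X - tconj X =
  inj1 (proj1 X - hconj (proj1 X)) + inj2 (proj2 X - hconj (proj2 X)).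
Proof.
elim/tens_ind: X => [a X Y EX EY||c b].
- have sub2 (W : lmodType F) (u v u' v' : W) :
      a *: u + v - (a *: u' + v') = a *: (u - u') + (v - v').
    by rewrite opprD addrACA scalerBr.
  rewrite tconj_linear (linearP proj1) (linearP proj2) /= !hconj_is_linear.
  rewrite !sub2 EX EY (linearP inj1) (linearP inj2) /=.
  by rewrite scalerDr addrACA.
- have conj0 (D : hurwitzType F) : hconj (0 : D) = 0.
    by rewrite /hconj linear0l scale0r subr0.
  by rewrite !linear0 !conj0 /tconj linear0 !subr0 !linear0 addr0.
rewrite tconj_tens proj1E proj2E !inj1E !inj2E /half_trace /hconj.
rewrite !linearZl_LR /=.
apply/matrixP=> i j; rewrite !mxE !linearB !linearZ /=.
by field.
Qed.

Lemma skew_decomp X : tskew X -> exists c b,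
  [/\ c \in trace0 C, b \in trace0 B & X = inj1 c + inj2 b].
Proof.
move=> Xs; have := subr_tconj X; rewrite Xs opprK -mulr2n -scaler_nat.
move/(canRL (scalerK twoF)) => ->.
exists (2%:R^-1 *: (proj1 X - hconj (proj1 X))).
exists (2%:R^-1 *: (proj2 X - hconj (proj2 X))).
split; last by rewrite scalerDr; congr (_ + _); rewrite linearZ.
  by apply: memvZ; rewrite mem_trace0 linearBl /= polar_hconj1 // subrr.
by apply: memvZ; rewrite mem_trace0 linearBl /= polar_hconj1 // subrr.
Qed.

Lemma hconj_one (D : hurwitzType F) : hone != 0 :> D -> hconj (hone : D) = hone.
Proof.
by move=> D1; rewrite /hconj polar11 // scaler_nat mulr2n addrK.
Qed.

Lemma skew_inj c b :
  c \in trace0 C -> b \in trace0 B -> tskew (inj1 c + inj2 b).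
Proof.
rewrite !mem_trace0 => /eqP c0 /eqP b0.
rewrite /tskew -[inj1 c]scale1r tconj_linear !scale1r inj1E inj2E !tconj_tens.
rewrite (hconj_trace0 c0) (hconj_trace0 b0) !hconj_one //.
by rewrite linearNl linearNr /= opprD.
Qed.

Lemma assoc_tens (c c' c'' : C) (b b' b'' : B) :
  assoc (tens c b) (tens c' b') (tens c'' b'') =
  tens (assoc c c' c'') (namul (namul b b') b'').
Proof.
rewrite /assoc !namul_tens linearBl /=; congr (_ - tens _ _).
by apply/esym/eqP; rewrite -subr_eq0 -/(assoc _ _ _) Bassoc.
Qed.

Lemma assoc_skew c1 b1 c2 b2 c3 b3 :
  assoc (inj1 c1 + inj2 b1) (inj1 c2 + inj2 b2) (inj1 c3 + inj2 b3) =
  inj1 (assoc c1 c2 c3).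
Proof.
rewrite !assocD1 !assocD2 !assocD3 !inj1E !inj2E !assoc_tens.
by rewrite !assoc_1l // !assoc_1m // !assoc_1r // !linear0l /= !addr0 !hmul1.
Qed.

(** A general [h] covers both a homogeneous projection and an automorphism. The x in C that [h]
    after [inj1] sends into the target form a subspace; it contains all associators of C, since
    scalar parts of their arguments drop out. *)
Lemma skew_assoc_span (h : 'End(A)) :
    (forall x y z, tskew x -> tskew y -> tskew z ->
      h (assoc x y z) \in (inj1 @: trace0 C)%VS) ->
  forall c, c \in trace0 C -> h (inj1 c) \in (inj1 @: trace0 C)%VS.
Proof.
move=> H c cT; have skew1 x : x \in trace0 C -> tskew (inj1 x).
  move=> xT; rewrite -[inj1 x]addr0 -(linear0 inj2).
  by apply: skew_inj; rewrite ?mem0v.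
suff /subvP/(_ c cT) : (trace0 C <= (h \o inj1) @^-1: (inj1 @: trace0 C))%VS.
  by rewrite -memv_preim comp_lfunE.
apply: trace0_sub_assoc => // x y z; rewrite -memv_preim comp_lfunE.
have [a [x0 [x0T ->]]] := trace0_decomp C1 char2 x.
have [a' [y0 [y0T ->]]] := trace0_decomp C1 char2 y.
have [a'' [z0 [z0T ->]]] := trace0_decomp C1 char2 z.
rewrite assoc_linear1 assoc_1l // scaler0 add0r.
rewrite assoc_linear2 assoc_1m // scaler0 add0r.
rewrite assoc_linear3 assoc_1r // scaler0 add0r.
have := assoc_skew x0 0 y0 0 z0 0; rewrite linear0 !addr0 => <-.
by apply: H; apply: skew1.
Qed.

(** The component of X in C0 annihilates associators with C0, hence with all of C, so
    [nuclear_trace0] makes it zero. *)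
Lemma skew_nucleus X : tskew X ->
    (forall y z, tskew y -> tskew z -> assoc X y z = 0) ->
  exists2 b, b \in trace0 B & X = inj2 b.
Proof.
move=> /skew_decomp[c [b [cT bT ->]]] H; exists b => //.
suff -> : c = 0 by rewrite linear0 add0r.
apply: nuclear_trace0 => //; last by apply/eqP; rewrite -mem_trace0.
move=> y z.
have [a' [y0 [y0T ->]]] := trace0_decomp C1 char2 y.
have [a'' [z0 [z0T ->]]] := trace0_decomp C1 char2 z.
rewrite assoc_linear2 assoc_1m // scaler0 add0r.
rewrite assoc_linear3 assoc_1r // scaler0 add0r.
apply: (can_inj inj1K); rewrite linear0 -(assoc_skew c b y0 0 z0 0).
by apply: H; apply: skew_inj; rewrite ?mem0v.
Qed.

Lemma skew_inj2_nuclear b y z : b \in trace0 B -> tskew y -> tskew z ->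
  assoc (inj2 b) y z = 0.
Proof.
move=> bT /skew_decomp[c [b' [_ _ ->]]] /skew_decomp[c' [b'' [_ _ ->]]].
rewrite -[inj2 b]add0r -(linear0 inj1) assoc_skew.
by rewrite -/(assoc1 _ _ 0) !linear0.
Qed.

Lemma limg_inj1 (h : 'End(A)) :
    (forall x y z, tskew x -> tskew y -> tskew z ->
      h (assoc x y z) \in (inj1 @: trace0 C)%VS) ->
    h e1 \in limg inj1 -> forall c, h (inj1 c) \in limg inj1.
Proof.
move=> H h1 c; have [a [c0 [c0T ->]]] := trace0_decomp C1 char2 c.
rewrite !linearP /= inj1E memvD ?memvZ //.
by apply: (subvP (limgS _ (subvf _))); apply: skew_assoc_span.
Qed.

Lemma limg_inj2 (h : 'End(A)) :
    (forall b, b \in trace0 B -> tskew (h (inj2 b)) /\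
       (forall y z, tskew y -> tskew z -> assoc (h (inj2 b)) y z = 0)) ->
    h e1 \in limg inj2 -> forall b, h (inj2 b) \in limg inj2.
Proof.
move=> H h1 b; have [a [b0 [b0T ->]]] := trace0_decomp B1 char2 b.
rewrite !linearP /= inj2E memvD ?memvZ //.
have [hs hn] := H _ b0T; have [b' _ ->] := skew_nucleus hs hn.
by rewrite memv_img ?memvf.
Qed.

End TensorHurwitz.

(** * Gradings on the tensor product *)

Section TensorGradings.
Variables (F : fieldType) (G : zmodType) (C B : hurwitzType F).
Hypothesis char2 : 2%N \notin [pchar F].
Hypotheses (C1 : hone != 0 :> C) (B1 : hone != 0 :> B).
Hypotheses (Bassoc : forall x y z : B, assoc x y z = 0).
Hypothesis dimC : (4 < \dim {:C})%N.
Local Notation A := (tensor C B).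
Local Notation e1 := (tens (hone : C) (hone : B)).
Local Notation inj1 := (@inj1 F C B).
Local Notation inj2 := (@inj2 F C B).

Section InvGrading.
Variables (X : G -> {vspace A}) (s : seq G) (p : G -> 'End(A)).
Hypotheses (Xgr : is_inv_grading (@tconj F C B) X) (Xp : is_projections X s p).

Lemma skew_component g x : tskew x -> tskew (p g x).
Proof.
move=> xs; rewrite /tskew -linearN /= -xs -[g in RHS]addr0.
rewrite (projection_homogeneous (@tconj_linear F C B) Xp Xp) //.
by move=> h v vh; rewrite addr0; apply: Xgr.2.
Qed.

Let e1_deg0 : e1 \in X 0.
Proof. exact: (grading_one Xgr.1 Xp (@tmul1 F C B) (@tmulr1 F C B)). Qed.

Let p_e1 g : p g e1 = if g == 0 then e1 else 0.
Proof. by have [_ _ pE _] := Xp; apply: pE. Qed.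

Lemma inj1_graded g c : p g (inj1 c) \in limg inj1.
Proof.
have [us pX pE psum] := Xp.
apply: limg_inj1 => // [x y z xs ys zs|]; last first.
  by rewrite p_e1 -inj1E; case: ifP => _; rewrite ?mem0v ?memv_img ?memvf.
(* Splitting x, y, z into homogeneous components, which are again skew, leaves homogeneous
   associators of skew elements; [p g] keeps or kills each of them. *)
rewrite (psum x) -/(assoc1 _ _ _) linear_sum linear_sum /=.
apply: memv_suml => h _; rewrite /assoc1 (psum y) -/(assoc2 _ _ _).
rewrite linear_sum linear_sum /=.
apply: memv_suml => k _; rewrite /assoc2 (psum z) linear_sum linear_sum /=.
apply: memv_suml => l _.
rewrite (pE (h + (k + l)) g (assoc _ _ _)); last first.
  by apply: (assoc_homogeneous Xgr.1).
case: ifP => _; last exact: mem0v.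
have /(skew_decomp char2 C1 B1)[c1 [b1 [_ _ ->]]] := skew_component h xs.
have /(skew_decomp char2 C1 B1)[c2 [b2 [_ _ ->]]] := skew_component k ys.
have /(skew_decomp char2 C1 B1)[c3 [b3 [_ _ ->]]] := skew_component l zs.
rewrite assoc_skew //; apply: memv_img.
by rewrite mem_trace0 polar_assoc // assoc_1l // linear0l.
Qed.

Lemma inj2_graded g b : p g (inj2 b) \in limg inj2.
Proof.
have [us pX pE psum] := Xp.
apply: limg_inj2 => // [{}b bT|]; last first.
  by rewrite p_e1 -inj2E; case: ifP => _; rewrite ?mem0v ?memv_img ?memvf.
have bs : tskew (inj2 b).
  by rewrite -[inj2 b]add0r -(linear0 inj1); apply: skew_inj; rewrite ?mem0v.
split=> [|y z ys zs]; first exact: skew_component.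
rewrite (psum y) -/(assoc2 _ _ _) linear_sum big1 // => h _ /=.
rewrite /assoc2 (psum z) linear_sum big1 // => k _ /=.
(* For y, z of degrees h, k, the associator with [p g (inj2 b)] is the component of degree g + (h +
   k) of the associator with [inj2 b], which is zero. *)
have := projection_homogeneous (@assoc_linear1 _ _ (p h y) (p k z)) Xp Xp.
move=> /(_ (h + k)) <- => [|l v vl]; last first.
  by apply: (assoc_homogeneous Xgr.1).
rewrite skew_inj2_nuclear ?linear0 //; exact: skew_component.
Qed.

Lemma inv_grading_tensor : exists (X1 : G -> {vspace C}) (X2 : G -> {vspace B}),
  [/\ is_grading X1, is_grading X2 & is_tensor_grading X1 X2 X].
Proof.
exists (fun g => inj1 @^-1: X g)%VS, (fun g => inj2 @^-1: X g)%VS.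
have X1gr := preim_grading (inj1K char2 B1) (@inj1M F C B) Xgr.1 Xp inj1_graded.
have X2gr := preim_grading (inj2K char2 C1) (@inj2M F C B) Xgr.1 Xp inj2_graded.
split=> //; apply: tensor_grading_intro X1gr.1 X2gr.1 Xgr.1.1 _.
move=> g h c b; rewrite -!memv_preim inj1E inj2E => cX bX.
by have := Xgr.1.2 _ _ _ _ cX bX; rewrite namul_tens hmulr1 hmul1.
Qed.

End InvGrading.

(** * From gradings on the factors to the tensor product *)

Section TensorGrading.
Variables (X : G -> {vspace A}) (X1 : G -> {vspace C}) (X2 : G -> {vspace B}).
Hypothesis Xd : is_decomposition X.
Hypotheses (X1gr : is_grading X1) (X2gr : is_grading X2).
Hypothesis X12 : is_tensor_grading X1 X2 X.

Lemma tens_component g h c b :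
  c \in X1 g -> b \in X2 h -> tens c b \in X (g + h).
Proof.
move=> cg bh; apply/(X12 (g + h)).2.
exists [:: (g, h)]; first by rewrite /= eqxx.
by rewrite big_seq1 mem_tensv.
Qed.

Lemma tensor_component_ind g (P : A -> Prop) :
    (forall a x y, P x -> P y -> P (a *: x + y)) -> P 0 ->
    (forall h k c b, h + k = g -> c \in X1 h -> b \in X2 k -> P (tens c b)) ->
  forall x, x \in X g -> P x.
Proof.
move=> PD P0 PT; apply: (is_dsum_ind PD P0 _ (X12 g)) => -[h k] x /eqP /= hk.
by apply: tensv_ind => // c b; apply: PT.
Qed.

Lemma tensor_inv_grading : is_inv_grading (@tconj F C B) X.
Proof.
split; last first.
  move=> g; apply: (tensor_component_ind (P := fun x => tconj x \in X g))
    => [a x y xX yX||h k c b <- ch bk].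
  - by rewrite tconj_linear memvD ?memvZ.
  - by rewrite /tconj linear0 mem0v.
  rewrite tconj_tens tens_component //.
    exact: (hurwitz_grading_hconj C1 X1gr).
  exact: (hurwitz_grading_hconj B1 X2gr).
split=> // g h x y xg; move: y.
apply: (tensor_component_ind (P := fun y => namul x y \in X _))
  => [a u v uX vX||g' h' c b <- cX bX].
- by rewrite linearPr memvD ?memvZ.
- by rewrite linear0r mem0v.
move: x xg; apply: (tensor_component_ind (P := fun x => namul x _ \in X _))
  => [a u v uX vX||g2 h2 c' b' <- cX' bX'].
- by rewrite linearPl memvD ?memvZ.
- by rewrite linear0l mem0v.
(* Regrouping the degrees by factor uses that [G] is commutative. *)
rewrite namul_tens addrACA tens_component //; first exact: X1gr.2.
exact: X2gr.2.
Qed.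

Lemma hurwitz_one_deg0 (D : hurwitzType F) (Y : G -> {vspace D}) :
  is_grading Y -> hone \in Y 0.
Proof.
move=> Ygr; have [s [p Yp]] := decomposition_projections Ygr.1.
exact: (grading_one Ygr Yp (@hmul1 F D) (@hmulr1 F D)).
Qed.

Lemma tensor_grading_preim1 g : X1 g = (inj1 @^-1: X g)%VS.
Proof.
apply: preim_component Xd X1gr.1 _ _; first exact: can_inj (inj1K char2 B1).
by move=> h c ch; rewrite inj1E -[h]addr0 tens_component ?hurwitz_one_deg0.
Qed.

Lemma tensor_grading_preim2 g : X2 g = (inj2 @^-1: X g)%VS.
Proof.
apply: preim_component Xd X2gr.1 _ _; first exact: can_inj (inj2K char2 C1).
by move=> h b bh; rewrite inj2E -[h]add0r tens_component ?hurwitz_one_deg0.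
Qed.

End TensorGrading.

(** * Isomorphisms of tensor product gradings *)

Section Isomorphisms.
Variables (X X' : G -> {vspace A}) (X1 X1' : G -> {vspace C}).
Variables (X2 X2' : G -> {vspace B}).
Hypotheses (Xd : is_decomposition X) (Xd' : is_decomposition X').
Hypotheses (X1gr : is_grading X1) (X2gr : is_grading X2).
Hypotheses (X1gr' : is_grading X1') (X2gr' : is_grading X2').
Hypothesis X12 : is_tensor_grading X1 X2 X.
Hypothesis X12' : is_tensor_grading X1' X2' X'.

Lemma tensor_iso_factors : inv_grading_iso (@tconj F C B) X X' ->
  grading_iso X1 X1' /\ grading_iso X2 X2'.
Proof.
case=> f [faut fconj fX]; have [[f' fK f'K] fM] := faut.
have fe1 := alg_aut_one (@tmul1 F C B) (@tmulr1 F C B) faut.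
have fassoc x y z : f (assoc x y z) = assoc (f x) (f y) (f z).
  by rewrite /assoc linearB /= !fM.
have fskew x : tskew (f x) <-> tskew x.
  rewrite /tskew -fconj -linearN /=; split=> [|->] //; exact: (can_inj fK).
split.
  apply: (preim_grading_iso (inj1K char2 B1) (@inj1M F C B) faut fX).
  - apply: limg_inj1 => // [x y z xs ys zs|].
      have /fskew/(skew_decomp char2 C1 B1)[c1 [b1 [_ _ xE]]] := xs.
      have /fskew/(skew_decomp char2 C1 B1)[c2 [b2 [_ _ yE]]] := ys.
      have /fskew/(skew_decomp char2 C1 B1)[c3 [b3 [_ _ zE]]] := zs.
      rewrite fassoc xE yE zE assoc_skew // memv_img //.
      by rewrite mem_trace0 polar_assoc // assoc_1l // linear0l.
    by rewrite fe1 -inj1E memv_img ?memvf.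
  - exact: tensor_grading_preim1 Xd X1gr X2gr X12.
  - exact: tensor_grading_preim1 Xd' X1gr' X2gr' X12'.
apply: (preim_grading_iso (inj2K char2 C1) (@inj2M F C B) faut fX).
- apply: limg_inj2 => // [b bT|]; last by rewrite fe1 -inj2E memv_img ?memvf.
  split=> [|y z ys zs].
    apply/fskew; rewrite -[inj2 b]add0r -(linear0 inj1).
    by apply: skew_inj; rewrite ?mem0v.
  rewrite -[y]f'K -[z]f'K -fassoc skew_inj2_nuclear ?linear0 //.
    by apply/fskew; rewrite f'K.
  by apply/fskew; rewrite f'K.
- exact: tensor_grading_preim2 Xd X1gr X2gr X12.
- exact: tensor_grading_preim2 Xd' X1gr' X2gr' X12'.
Qed.

(** The tensor product of the two isomorphisms works; it commutes with the involution by
    [alg_aut_hconj] in each factor. *)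
Lemma tensor_iso_of_factors : grading_iso X1 X1' -> grading_iso X2 X2' ->
  inv_grading_iso (@tconj F C B) X X'.
Proof.
case=> f1 [f1aut f1X] [f2 [f2aut f2X]].
have [[g1 f1K g1K] f1M] := f1aut; have [[g2 f2K g2K] f2M] := f2aut.
exists (tmap f1 f2); split.
- split.
    have f1_0 : lker f1 == 0%VS by apply/lker0P/(can_inj f1K).
    have f2_0 : lker f2 == 0%VS by apply/lker0P/(can_inj f2K).
    exists (tmap f1^-1 f2^-1).
      elim/tens_ind => [a x y Ex Ey||u v]; rewrite ?linear0 //.
        by rewrite !linearP /= Ex Ey.
      by rewrite !tmap_tens !lker0_lfunK.
    elim/tens_ind => [a x y Ex Ey||u v]; rewrite ?linear0 //.
      by rewrite !linearP /= Ex Ey.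
    by rewrite !tmap_tens !lker0_lfunVK.
  move=> x y; elim/tens_ind: x => [a x x' Ex Ex'||c b];
    rewrite ?linear0l ?linear0 ?linear0l //.
    by rewrite linearPl /= !linearP /= linearPl /= Ex Ex'.
  elim/tens_ind: y => [a y y' Ey Ey'||c' b'];
    rewrite ?linear0r ?linear0 ?linear0r //.
    by rewrite linearPr /= !linearP /= linearPr /= Ey Ey'.
  by rewrite namul_tens !tmap_tens namul_tens f1M f2M.
- elim/tens_ind => [a x y Ex Ey||c b].
  + by rewrite tconj_linear !linearP /= tconj_linear Ex Ey.
  + by rewrite /tconj !linear0.
  by rewrite tconj_tens !tmap_tens tconj_tens !alg_aut_hconj.
move=> g; apply/eqP; rewrite eqEsubv; apply/andP; split; apply/subvP=> y.
  case/memv_imgP=> x xg ->; move: x xg.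
  apply: (tensor_component_ind X12 (P := fun x => tmap f1 f2 x \in X' g))
    => [a x x' Ex Ex'||h k c b <- ch bk].
  - by rewrite linearP memvD ?memvZ.
  - by rewrite linear0 mem0v.
  by rewrite tmap_tens (tens_component X12') // -?f1X -?f2X memv_img.
move: y; apply: (tensor_component_ind X12' (P := fun y => y \in _))
  => [a x x' Ex Ex'||h k c b <-].
- by rewrite memvD ?memvZ.
- exact: mem0v.
rewrite -f1X -f2X => /memv_imgP[c' c'X ->] /memv_imgP[b' b'X ->].
by rewrite -tmap_tens memv_img // (tens_component X12).
Qed.

End Isomorphisms.
End TensorGradings.

Theorem theorem3p13 (F : fieldType) (charF : 2%N \notin [pchar F])
    (G : zmodType) (C B : hurwitzType F)
    (dimC : \dim {:C} = 8%N) (dimB : \dim {:B} = 2%N \/ \dim {:B} = 4%N) :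
  (forall X : G -> {vspace tensor C B}, is_decomposition X ->
     (is_inv_grading (@tconj F C B) X <->
      exists (X1 : G -> {vspace C}) (X2 : G -> {vspace B}),
        [/\ is_grading X1, is_grading X2 & is_tensor_grading X1 X2 X])) /\
  (forall (X X' : G -> {vspace tensor C B})
          (X1 X1' : G -> {vspace C}) (X2 X2' : G -> {vspace B}),
     is_inv_grading (@tconj F C B) X -> is_inv_grading (@tconj F C B) X' ->
     is_grading X1 -> is_grading X2 -> is_tensor_grading X1 X2 X ->
     is_grading X1' -> is_grading X2' -> is_tensor_grading X1' X2' X' ->
     (inv_grading_iso (@tconj F C B) X X' <->
      grading_iso X1 X1' /\ grading_iso X2 X2')).
Proof.
(* The zero algebra satisfies the Hurwitz axioms; positive dimension excludes it. *)
have one_neq0 (D : hurwitzType F) : (0 < \dim {:D})%N -> hone != 0 :> D.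
  apply: contraTneq => D1; rewrite lt0n negbK dimv_eq0 -subv0.
  by apply/subvP=> x _; rewrite memv0 -[x]hmul1 D1 linear0l.
have C1 : hone != 0 :> C by apply: one_neq0; rewrite dimC.
have B1 : hone != 0 :> B by apply: one_neq0; case: dimB => ->.
have Bassoc : forall x y z : B, assoc x y z = 0.
  by apply: assoc_dim4 => //; case: dimB => ->.
have dimC4 : (4 < \dim {:C})%N by rewrite dimC.
split=> [X Xd|X X' X1 X1' X2 X2' Xgr X'gr X1gr X2gr X12 X1gr' X2gr' X12'].
  split=> [Xgr|[X1 [X2 [X1gr X2gr X12]]]]; last exact: tensor_inv_grading X12.
  have [s [p Xp]] := decomposition_projections Xd.
  exact: inv_grading_tensor Xgr Xp.
split=> [|[]].
  exact: (tensor_iso_factors charF C1 B1 Bassoc dimC4 Xgr.1.1 X'gr.1.1).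
exact: tensor_iso_of_factors.
Qed.
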